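(* Let $n,t\ge 1$ be integers, suppose $\mathcal{A}\subseteq\mathcal{M}_n(t)$, and define the nonnegative real number $x$ by $|\mathcal{A}|=\left\langle {x \atop t}\right\rangle$. Then $|\partial\mathcal{A}|\ge \left\langle {x \atop t-1}\right\rangle$.
   Context: $\mathcal{M}_n(t)$ denotes the family of $t$-element multisets of $[n]=\{1,\ldots,n\}$. For real $x\ge 0$, $\left\langle {x \atop t}\right\rangle = x(x+1)\cdots(x+t-1)/t!$ (so for integer $n$, $\left\langle {n \atop t}\right\rangle=\binom{n+t-1}{t}=|\mathcal{M}_n(t)|$). For $\mathcal{A}\subseteq\mathcal{M}_n(t)$, its shadow is $\partial\mathcal{A}=\{C\in\mathcal{M}_n(t-1)\mid C\subset A \text{ for some } A\in\mathcal{A}\}$ (multiset inclusion).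
   Formalization: The case where t = 1 and the family A is empty is excluded: there x = 0 and the shadow is empty, while the binomial-type symbol with x = 0 and t − 1 = 0 equals 1, so the claimed inequality would read 0 ≥ 1. *)

(* Defs.v *)
(* Libraries: MathComp, finmap (finite sets and multisets), and the real
   numbers of MathComp-Analysis. *)
From HB Require Import structures.
From mathcomp Require Import all_boot all_order all_algebra.
From mathcomp Require Import finmap multiset.
From mathcomp Require Import reals.

Set Implicit Arguments.
Unset Strict Implicit.
Unset Printing Implicit Defensive.

Local Open Scope fset_scope.
Local Open Scope mset_scope.

(* The ground set [n] = {1, ..., n} is the type 'I_n, whose elements are
   numbered from 0. *)

(* Enumerated as the multisets underlying the t-tuples; lemma in_msets gives
   the intended characterization by cardinality with multiplicity. *)
Definition msets (n t : nat) : {fset {mset 'I_n}} :=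
  [fset seq_mset (val s) | s in {: t.-tuple 'I_n}].

Lemma in_msets (n t : nat) (C : {mset 'I_n}) : (C \in msets n t) = (size C == t).
Proof.
apply/imfsetP/eqP => [[s _ ->]|sizeC].
  by rewrite (perm_size (perm_eq_seq_mset _)) size_tuple.
have sC : size (C : seq 'I_n) == t by apply/eqP.
by exists (Tuple sC); rewrite //= seq_mset_id.
Qed.

(* The parameter t is explicit because an empty family does not determine
   it; t.-1 is t - 1 for t >= 1. *)
Definition shadow (n t : nat) (F : {fset {mset 'I_n}}) : {fset {mset 'I_n}} :=
  [fset C in msets n t.-1 | [exists A : F, msubset C (val A)]].

Lemma shadowP (n t : nat) (F : {fset {mset 'I_n}}) (C : {mset 'I_n}) :
  reflect (C \in msets n t.-1 /\ exists2 A, A \in F & msubset C A)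
          (C \in shadow t F).
Proof.
rewrite !inE /=.
apply: (iffP andP) => -[CM].
  by move=> /existsP[A CA]; split=> //; exists (val A); rewrite ?(valP A).
by move=> [A AF CA]; split=> //; apply/existsP; exists [` AF].
Qed.

Local Open Scope ring_scope.

(* x (x + 1) ... (x + t - 1) / t!, equal to 1 when t = 0. *)
Definition mbinom (R : realType) (x : R) (t : nat) : R :=
  (\prod_(i < t) (x + i%:R)) / (t`!)%:R.

Lemma mbinom_nat (R : realType) (n t : nat) :
  (0 < n)%N -> mbinom (n%:R : R) t = ('C((n + t).-1, t))%:R.
Proof.
move=> n_gt0; have tF0 : (t`!)%:R != 0 :> R.
  by rewrite Num.Theory.pnatr_eq0 -lt0n fact_gt0.
apply: (GRing.mulIf tF0); rewrite /mbinom GRing.divfK // -GRing.natrM bin_ffact.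
elim: t {tF0} => [|t IHt]; first by rewrite big_ord0 ffactn0.
rewrite big_ord_recr /= IHt -GRing.natrD -GRing.natrM addnS /=.
by congr (_%:R); case: n n_gt0 {IHt} => // m _; rewrite addSn ffactSS mulnC.
Qed.

(* Main.v *)
(* Write <x, t> for mbinom x t. Pick an element v occurring in some member of F
   and split F into the members avoiding v (del v F) and those containing v,
   with one copy of v removed (link v F). If D contains the shadow of F, then it
   contains link v F, so it suffices to treat |link v F| = <w, t-1> with w < x.
   Splitting D in the same way, del v D contains the shadow of del v F and
   link v D that of link v F, hence |D| >= <y, t-1> + <w, t-2> by induction,
   where |del v F| = <y, t>. It remains to see that
     <x, t> = <y, t> + <w, t-1> implies <y, t-1> + <w, t-2> >= <x, t-1>.
   There x-1 <= y <= x, and <y, t-1> is a concave function of <y, t> because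
   1 / (y (y+1) ... (y+t-2)) is convex; the chord from x-1 to x gives the
   claim. No compression is needed. *)
Require Import Defs.
From mathcomp Require Import all_boot all_order all_algebra.
From mathcomp Require Import finmap multiset.
From mathcomp Require Import reals.
From mathcomp Require Import ring lra.

Local Open Scope ring_scope.

Import Order.TTheory GRing.Theory Num.Theory.

Lemma mbinom0r (R : realType) (x : R) : mbinom x 0 = 1.
Proof. by rewrite /mbinom big_ord0 fact0 divr1. Qed.

Lemma mbinomSr (R : realType) (x : R) t :
  mbinom x t.+1 = mbinom x t * (x + t%:R) / t.+1%:R.
Proof.
by rewrite /mbinom big_ord_recr /= factS natrM invfM; ring.
Qed.

Lemma mbinom1l (R : realType) t : mbinom (1 : R) t = 1.
Proof. by rewrite (mbinom_nat R (n := 1)) // add1n binn. Qed.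

Lemma mbinom0S (R : realType) t : mbinom (0 : R) t.+1 = 0.
Proof. by rewrite /mbinom big_ord_recl /= addr0 !mul0r. Qed.

Lemma mbinom_ge0 (R : realType) (x : R) t : 0 <= x -> 0 <= mbinom x t.
Proof.
by move=> x0; apply: divr_ge0 => //; apply: prodr_ge0 => i _; apply: addr_ge0.
Qed.

Lemma mbinom_gt0 (R : realType) (x : R) t : 0 < x -> 0 < mbinom x t.
Proof.
move=> x0; apply: divr_gt0; last by rewrite ltr0n fact_gt0.
by apply: prodr_gt0 => i _; apply: ltr_wpDr.
Qed.

Lemma ler_mbinom (R : realType) (x y : R) t :
  0 <= x -> x <= y -> mbinom x t <= mbinom y t.
Proof.
move=> x0 xy; rewrite /mbinom ler_wpM2r ?invr_ge0 //.
by apply: ler_prod => i _; rewrite addr_ge0 //= lerD2r.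
Qed.

Lemma ltr_mbinom (R : realType) (x y : R) t :
  0 <= x -> x < y -> mbinom x t.+1 < mbinom y t.+1.
Proof.
move=> x0 xy; rewrite !mbinomSr ltr_pM2r ?invr_gt0 ?ltr0Sn //.
apply: (@le_lt_trans _ _ (mbinom y t * (x + t%:R))).
  by rewrite ler_wpM2r ?addr_ge0 // ler_mbinom // ltW.
by rewrite ltr_pM2l ?ltrD2r // mbinom_gt0 // (le_lt_trans x0).
Qed.

Lemma mbinom_pascal (R : realType) (x : R) t :
  mbinom x t.+1 = mbinom (x - 1) t.+1 + mbinom x t.
Proof.
elim: t => [|t IHt]; first by rewrite !mbinomSr !mbinom0r; field.
rewrite mbinomSr [X in _ = X + _]mbinomSr.
have -> : mbinom (x - 1) t.+1 = mbinom x t.+1 - mbinom x t.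
  by rewrite IHt addrK.
have k1 : t.+1%:R != 0 :> R by rewrite pnatr_eq0.
have k2 : t.+2%:R != 0 :> R by rewrite pnatr_eq0.
move: k1 k2; rewrite mbinomSr -!natr1 => k1 k2.
by field; rewrite k1 k2.
Qed.

(** As a polynomial in [y], [mbinom y t.+1] vanishes at 0 and reaches [c] or more at a large point,
    so the intermediate value theorem applies. *)
Lemma mbinom_surj (R : realType) t (c : R) :
  0 <= c -> exists2 y, 0 <= y & mbinom y t.+1 = c.
Proof.
move=> c0; pose p : {poly R} :=
  (t.+1`!%:R)^-1 *: \prod_(i < t.+1) ('X + (i%:R)%:P) - c%:P.
have pE y : p.[y] = mbinom y t.+1 - c.
  rewrite /p !hornerE horner_prod mulrC; congr (_ / _ - _).
  by apply: eq_bigr => i _; rewrite !hornerE.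
(* [mbinom b t] is at least 1 because [1 <= b], and the last factor [(b + t) / t.+1] of
   [mbinom b t.+1] is at least [c]. *)
pose b := c * t.+1%:R + 1.
have b1 : 1 <= b by rewrite lerDr mulr_ge0.
have b0 : 0 <= b by apply: le_trans b1.
suff p0b : p.[0] <= 0 <= p.[b].
  have [y /andP[y0 _] /rootP py] := poly_ivt b0 p0b.
  by exists y => //; apply/eqP; rewrite -subr_eq0 -pE py.
rewrite !pE mbinom0S sub0r oppr_le0 c0 subr_ge0 /=.
rewrite mbinomSr ler_pdivlMr ?ltr0Sn //.
apply: (@le_trans _ _ (1 * b)); first by rewrite mul1r lerDl.
apply: ler_pM => //; last by rewrite lerDl.
by rewrite -(mbinom1l R t) ler_mbinom.
Qed.

(* Divided by the product of the three values, this says that the reciprocal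
   of mbinom is convex; the form below remains valid at 0. *)
Lemma mbinom_inv_convex (R : realType) (a b c : R) t :
  0 <= a -> a <= b -> b <= c ->
  mbinom a t * mbinom c t * (c - a) <=
  mbinom b t * mbinom c t * (c - b) + mbinom a t * mbinom b t * (b - a).
Proof.
move=> a0 ab bc; elim: t => [|t IHt]; first by rewrite !mbinom0r; lra.
have b0 := le_trans a0 ab; have c0 := le_trans b0 bc.
have mc := ler_mbinom R a c t a0 (le_trans ab bc).
rewrite !mbinomSr.
move: (mbinom a t) (mbinom b t) (mbinom c t) (mbinom_ge0 R a t a0)
  (mbinom_ge0 R b t b0) mc IHt => A B C A0 B0 AC IHt.
have k0 : 0 <= t%:R :> R by [].
move: (t%:R) k0 => k k0.
have s0 : 0 < t.+1%:R :> R by [].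
move: (t.+1%:R) s0 => s s0.
(* The first summand is a nonnegative multiple of the induction hypothesis; the remainder is
   nonnegative because [A <= C]. *)
rewrite -subr_ge0 [X in 0 <= X](_ : _ = s^-1 ^+ 2 *
  ((a + k) * (c + k) *
     (B * C * (c - b) + A * B * (b - a) - A * C * (c - a)) +
   B * (c - b) * (b - a) * ((C - A) * (c + k) + A * (c - a)))); last first.
  by field; rewrite gt_eqF.
rewrite mulr_ge0 ?exprn_ge0 ?invr_ge0 ?(ltW s0) // addr_ge0 //.
  by rewrite mulr_ge0 ?subr_ge0 // mulr_ge0 // addr_ge0.
rewrite mulr_ge0 ?addr_ge0 ?mulr_ge0 ?subr_ge0 ?addr_ge0 //.
exact: le_trans bc.
Qed.

(* Since mbinom _ t.+1 is mbinom _ t times an affine function of slope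
   1 / t.+1, the two sides differ by 1 / t.+1 times the difference of the sides
   in mbinom_inv_convex. *)
Lemma mbinom_chord (R : realType) (a b c : R) t :
  0 <= a -> a <= b -> b <= c ->
  (mbinom c t - mbinom a t) * (mbinom b t.+1 - mbinom a t.+1) <=
  (mbinom b t - mbinom a t) * (mbinom c t.+1 - mbinom a t.+1).
Proof.
move=> a0 ab bc; have := mbinom_inv_convex R a b c t a0 ab bc.
rewrite !mbinomSr.
move: (mbinom a t) (mbinom b t) (mbinom c t) => A B C H.
have s0 : 0 < t.+1%:R :> R by [].
move: (t.+1%:R) s0 => s s0.
rewrite -subr_ge0 [X in 0 <= X](_ : _ = s^-1 *
  (B * C * (c - b) + A * B * (b - a) - A * C * (c - a))); last first.
  by field; rewrite gt_eqF.
by rewrite mulr_ge0 ?subr_ge0 // invr_ge0 ltW.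
Qed.

Lemma mbinom_split (R : realType) (x y w : R) t :
  1 <= x -> 0 <= y -> 0 <= w -> w <= x ->
  mbinom x t.+2 = mbinom y t.+2 + mbinom w t.+1 ->
  mbinom x t.+1 <= mbinom y t.+1 + mbinom w t.
Proof.
move=> x1 y0 w0 wx e; have x0 : 0 < x by apply: lt_le_trans x1.
have a0 : 0 <= x - 1 by rewrite subr_ge0.
have yx : y <= x.
  rewrite leNgt; apply/negP => /(ltr_mbinom R x y t.+1 (ltW x0)).
  by have := mbinom_ge0 R w t.+1 w0; lra.
have ay : x - 1 <= y.
  rewrite leNgt; apply/negP => /(ltr_mbinom R _ _ t.+1 y0).
  by have := ler_mbinom R w x t.+1 w0 wx; have := mbinom_pascal R x t.+1; lra.
have Px : 0 < mbinom x t.+1 by apply: mbinom_gt0.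
(* In the notation introduced below, Pascal's rule turns this chord inequality into
   [p * (P - W) <= (Y - A) * P] with [A = P - p]. With [p * W <= u * P] it gives
   [P * P <= (Y + u) * P]. *)
have := mbinom_chord R _ _ _ t.+1 a0 ay yx.
have -> : mbinom y t.+2 - mbinom (x - 1) t.+2 = mbinom x t.+1 - mbinom w t.+1.
  by have := mbinom_pascal R x t.+1; lra.
have -> : mbinom x t.+2 - mbinom (x - 1) t.+2 = mbinom x t.+1.
  by have := mbinom_pascal R x t.+1; lra.
have := mbinom_pascal R x t.
(* The factor [(z + t) / t.+1] leading from [mbinom z t] to [mbinom z t.+1] increases with [z]. *)
have : mbinom x t * mbinom w t.+1 <= mbinom w t * mbinom x t.+1.
  have p0 := mbinom_ge0 R x t (ltW x0); have W0 := mbinom_ge0 R w t w0.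
  rewrite !mbinomSr; move: (mbinom x t) (mbinom w t) p0 W0 => p W p0 W0.
  rewrite -!mulrA [leRHS]mulrCA !ler_wpM2l //.
  by rewrite ler_pM2r ?invr_gt0 ?ltr0Sn // lerD2r.
move: (mbinom x t.+1) (mbinom y t.+1) (mbinom (x - 1) t.+1) (mbinom x t)
  (mbinom w t) (mbinom w t.+1) Px => P Y A p u W P0 h1 e1 h2.
have eA : A = P - p by rewrite e1 addrK.
by rewrite -(ler_pM2r P0) mulrDl; rewrite eA in h2; lra.
Qed.

Section Families.

Local Open Scope mset_scope.
Local Open Scope fset_scope.

Variable K : choiceType.
Implicit Types (F D : {fset {mset K}}) (A B : {mset K}) (v : K).

Definition link v F : {fset {mset K}} :=
  [fset (A `\ v)%mset | A in [fset A in F | v \in (A : {mset K})]].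

Definition del v F : {fset {mset K}} := [fset A in F | v \notin (A : {mset K})].

Lemma in_link v F B : (B \in link v F) = ((v +` B)%mset \in F).
Proof.
apply/imfsetP/idP => [[A /=]|vB].
  by rewrite !inE => /andP[AF vA] ->; rewrite msetB1K.
by exists (v +` B)%mset; rewrite ?msetD1K // !inE mset1D1 andbT.
Qed.

Lemma card_link_del v F : #|` F| = (#|` link v F| + #|` del v F|)%N.
Proof.
rewrite card_in_imfset; last first.
  move=> A B /=; rewrite !inE => /andP[_ vA] /andP[_ vB] e.
  by rewrite -(msetB1K vA) e msetB1K.
rewrite -cardfsUI [X in (_ + X)%N](_ : _ = 0%N) ?addn0; last first.
  apply/eqP; rewrite cardfs_eq0; apply/eqP/fsetP => A; rewrite !inE.
  by case: (v \in (A : {mset K})); rewrite !(andbF, andbT).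
by congr #|` _|; apply/fsetP => A; rewrite !inE -andb_orr orbN andbT.
Qed.

Lemma size_mset1D v A : size (v +` A)%mset = (size A).+1.
Proof.
have /perm_size -> : perm_eq (v +` A)%mset (v :: A).
  apply: perm_trans (perm_eq_seq_mset _).
  by rewrite mset_cons seq_mset_id.
by [].
Qed.

Lemma mset_size_gt0 A t : size A = t.+1 -> exists v, v \in A.
Proof.
rewrite -[A]seq_mset_id; case: (A : seq K) => [|v s] sA.
  by move: sA; rewrite (perm_size (perm_eq_seq_mset _)).
by exists v; rewrite mset_cons mset1D1.
Qed.

(** Induction on [t] handles links, and an inner induction on the size of [F] handles deletions.
    Allowing any [D] that contains the shadow lets the hypotheses pass to [link v D] and [del v D]
    without computing their shadows. *)
Lemma shadow_lower_bound (R : realType) t (x : R) F D :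
  {in F, forall A : {mset K}, size A = t.+1} ->
  {in F, forall A : {mset K}, {in (A : {mset K}), forall v, (A `\ v)%mset \in D}} ->
  (t = 0%N -> F <> fset0) ->
  0 <= x -> (#|` F|)%:R = mbinom x t.+1 -> mbinom x t <= (#|` D|)%:R.
Proof.
elim: t x F D => [|t IHt] x F D.
  move=> sF FD /(_ erefl)/eqP/fset0Pn[A AF] x0 _.
  have [v vA] := mset_size_gt0 A _ (sF A AF).
  rewrite mbinom0r ler1n cardfs_gt0; apply/fset0Pn.
  by exists (A `\ v)%mset; apply: FD.
have [m] := ubnP #|` F|; elim: m x F D => // m IHm x F D Fm sF FD _ x0 cF.
have [F0|/fset0Pn[A AF]] := eqVneq F fset0.
  case: (ltgtP 0 x) x0 => // [x0|<-] _; last by rewrite mbinom0S.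
  by have := mbinom_gt0 R x t.+2 x0; rewrite -cF F0 cardfs0 ltxx.
have [v vA] := mset_size_gt0 A _ (sF A AF).
have linkF0 : link v F != fset0.
  by apply/fset0Pn; exists (A `\ v)%mset; rewrite in_link msetB1K.
(* A nonempty [F] has at least [1 = mbinom 1 t.+2] members. *)
have x1 : 1 <= x.
  rewrite leNgt; apply/negP => /(ltr_mbinom R _ _ t.+1 x0).
  rewrite mbinom1l -cF (ltr_nat R _ 1) ltnS leqn0 cardfs_eq0 => /eqP F0.
  by rewrite F0 in_fset0 in AF.
have linkFD : (#|` link v F| <= #|` D|)%N.
  apply/fsubset_leq_card/fsubsetP => B; rewrite in_link => vB.
  by rewrite -(msetD1K v B); apply: FD => //; rewrite mset1D1.
have [w w0 cw] := mbinom_surj R t _ (ler0n R #|` link v F|).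
have [y y0 cy] := mbinom_surj R t.+1 _ (ler0n R #|` del v F|).
have [xw|wx] := leP x w.
  apply: le_trans (ler_mbinom R _ _ t.+1 x0 xw) _.
  by rewrite cw ler_nat.
(* Since [v] lies in a member of [F], the link is nonempty, as the base case [t = 0] demands. *)
have hw : mbinom w t <= (#|` link v D|)%:R.
  apply: (IHt w (link v F)) => //; last by move=> _; apply/eqP.
    move=> B; rewrite in_link => /sF; rewrite size_mset1D.
    by case.
  move=> B; rewrite in_link => vB u uB; rewrite in_link.
  have -> : (v +` (B `\ u) = (v +` B) `\ u)%mset.
    by rewrite msetDBA // msub1set.
  by apply: FD => //; rewrite in_mset1D uB orbT.
have hy : mbinom y t.+1 <= (#|` del v D|)%:R.
  apply: (IHm y (del v F)) => //.
  (* The nonempty link also makes [del v F] strictly smaller than [F]. *)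
  - rewrite -ltnS; apply: leq_trans Fm; rewrite ltnS (card_link_del v F).
    by rewrite -[X in (X < _)%N]add0n ltn_add2r cardfs_gt0.
  - by move=> B; rewrite !inE => /andP[/sF].
  - move=> B; rewrite !inE => /andP[BF vB] u uB; rewrite !inE FD //=.
    by apply: contra vB; apply/msubset_subset/msubD1set.
rewrite (card_link_del v D) natrD addrC.
apply: le_trans (lerD hy hw); apply: mbinom_split => //; first exact: ltW.
by rewrite -cF cy cw (card_link_del v F) natrD addrC.
Qed.

End Families.

Theorem theorem7 (R : realType) (n t : nat) (n_ge1 : (1 <= n)%N)
    (t_ge1 : (1 <= t)%N) (A : {fset {mset 'I_n}%mset})
    (A_sub : (A `<=` msets n t)%fset)
    (* the family A = fset0 with t = 1 is excluded: there x = 0, the shadow is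
       empty and mbinom 0 0 = 1 *)
    (A_nondeg : t = 1%N -> A <> fset0)
    (x : R) (x_ge0 : 0 <= x) (card_A : (#|` A |)%:R = mbinom x t) :
  mbinom x t.-1 <= (#|` shadow t A |)%:R.
Proof.
case: t t_ge1 A_sub A_nondeg card_A => // t _ A_sub A_nondeg card_A.
have sizeA : {in A, forall B : {mset 'I_n}%mset, size B = t.+1}.
  by move=> B /(fsubsetP A_sub); rewrite in_msets => /eqP.
apply: (shadow_lower_bound _ _ t x A) => // [B BA v vB | t0]; last first.
  by apply: A_nondeg; rewrite t0.
apply/shadowP; split; last by exists B => //; apply: msubD1set.
rewrite in_msets -eqSS -(size_mset1D _ v) msetB1K //.
by apply/eqP/sizeA.
Qed.
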